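(* For every connected graph $G$ on $n$ vertices, $$k_{\min}(G)\;\geq\;\max\bigl(\mathrm{diam}(G),\ \lceil\log_2 n\rceil\bigr).$$
   Context: Graphs are finite, simple, connected and undirected; $d_G$ is the shortest-path distance and $\mathrm{diam}(G)=\max_{u,v}d_G(u,v)$. For a generating set $S\subseteq\mathbb{Z}_2^k\setminus\{0\}$, $\mathrm{Cay}(\mathbb{Z}_2^k,S)$ is the graph on $\mathbb{Z}_2^k$ with edges $\{g,g+s\}$, $s\in S$. $k_{\min}(G)$ is the least $k$ such that $G$ embeds isometrically (via a distance-preserving map of vertex sets) into $\mathrm{Cay}(\mathbb{Z}_2^k,S)$ for some such $S$. *)

(* Defs.v *)
From mathcomp Require Import all_boot all_order all_algebra all_fingroup.
Set Implicit Arguments.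
Unset Strict Implicit.
Unset Printing Implicit Defensive.
Import GRing.Theory.

(* The null graph is not counted as connected. *)
Record graph := Graph {
  vertex :> finType;
  adj : rel vertex;
  adj_sym : symmetric adj;
  adj_irrefl : irreflexive adj;
  vertex_gt0 : 0 < #|vertex|;
  adj_connected : forall x y, connect adj x y
}.

Section Distance.
Variables (T : finType) (e : rel T).

Definition walk (m : nat) (x y : T) : bool :=
  [exists p : m.-tuple T, path e x p && (last x p == y)].

(* The least length of a walk from x to y. A shortest walk repeats no vertex,
   so its length is less than #|T|; if y is not reachable from x, the value is
   #|T|. *)
Definition dist (x y : T) : nat :=
  find (fun m => walk m x y) (iota 0 #|T|).

Lemma walkP m x y :
  reflect (exists p, [/\ path e x p, last x p = y & size p = m]) (walk m x y).
Proof.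
apply: (iffP existsP) => [[p /andP[pp /eqP lp]]|[p [pp lp /eqP sp]]].
  by exists p; rewrite size_tuple.
by exists (Tuple sp); rewrite pp lp /=.
Qed.

Lemma dist_min p x y : path e x p -> last x p = y -> dist x y <= size p.
Proof.
move=> pp lp; rewrite leqNgt; apply/negP => lt_p.
have := before_find 0 lt_p; rewrite nth_iota ?add0n; last first.
  by apply: leq_trans lt_p _; rewrite -[leqRHS](size_iota 0) find_size.
by suff -> : walk (size p) x y by []; apply/walkP; exists p.
Qed.

Lemma dist_attained x y : connect e x y ->
  exists p, [/\ path e x p, last x p = y & size p = dist x y].
Proof.
case/connectP => p0 /shortenP[p pp up _] ->.
set z := last x p; apply: (elimT (walkP (dist x z) x z)).
have sp : size p < #|T|.
  by rewrite -ltnS -[(size p).+1]/(size (x :: p)) -(card_uniqP up) ltnS max_card.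
have hp : has (fun m => walk m x z) (iota 0 #|T|).
  apply/hasP; exists (size p); first by rewrite mem_iota.
  by apply/walkP; exists p.
have := nth_find 0 hp; rewrite nth_iota ?add0n //.
by rewrite -[ltnRHS](size_iota 0) -has_find.
Qed.

End Distance.

Definition gdist (G : graph) : G -> G -> nat := dist (@adj G).

Definition diam (G : graph) : nat := \max_(u : G) \max_(v : G) gdist u v.

(* The simple graph Cay(Z_2^k, S) when connection_set S holds below. *)
Definition cayley k (S : {set 'rV['Z_2]_k}) : rel 'rV['Z_2]_k :=
  fun g h => [exists s in S, h == (g + s)%R].

(* The group structure on 'rV['Z_2]_k is the additive one. *)
Definition connection_set k (S : {set 'rV['Z_2]_k}) : bool :=
  (0%R \notin S) && (<<S>>%g == [set: 'rV['Z_2]_k]).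

Definition embeds (G : graph) (k : nat) : bool :=
  [exists S : {set 'rV['Z_2]_k}, connection_set S &&
    [exists f : {ffun G -> 'rV['Z_2]_k},
      [forall u, forall v, dist (cayley S) (f u) (f v) == gdist u v]]].

(* Some k always works: send each vertex u to the basis vector e_u of Z_2^#|G|
   and take S to be the set of all e_u + e_v, for u adjacent to v, together with
   one e_r so that S generates. *)
Section Existence.
Variable G : graph.
Local Open Scope ring_scope.

Local Notation V := 'rV['Z_2]_#|G|.
Let c (u : G) : V := delta_mx 0 (enum_rank u).

Lemma addvv k (x : 'rV['Z_2]_k) : x + x = 0.
Proof. by apply/rowP => i; rewrite !mxE; case: (x 0 i) => [[|[|]]] // ?; apply: val_inj. Qed.

Let cE u w : c u 0 (enum_rank w) = (w == u)%:R.
Proof. by rewrite mxE eqxx (inj_eq enum_rank_inj). Qed.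

Let parity (x : V) : 'Z_2 := \sum_i x 0 i.

Let parityD x y : parity (x + y) = parity x + parity y.
Proof. by rewrite -big_split; apply: eq_bigr => i _; rewrite mxE. Qed.

Let parity_c u : parity (c u) = 1.
Proof.
rewrite /parity (bigD1 (enum_rank u)) //= cE eqxx big1 ?addr0 // => i.
by rewrite mxE eqxx => /negbTE ->.
Qed.

Let parity_cc u v : parity (c u + c v) = 0.
Proof. by rewrite parityD !parity_c; apply: val_inj. Qed.

Let edges : {set V} := [set x | [exists u, exists v, adj u v && (x == c u + c v)]].

Let edgesP x : reflect (exists u v, adj u v /\ x = c u + c v) (x \in edges).
Proof.
rewrite inE; apply: (iffP existsP) => [[u /existsP[v /andP[a /eqP ->]]]|].
  by exists u, v.
by move=> [u [v [a ->]]]; exists u; apply/existsP; exists v; rewrite a eqxx.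
Qed.

Let edge_path n : forall (l : seq V) u v, size l = n -> {subset l <= edges} ->
  \sum_(s <- l) s = c u + c v ->
  exists p, [/\ path (@adj G) u p, last u p = v & (size p <= n)%N].
Proof.
elim: n => [|n IH] l u v sl le_l sum_l.
  move: sum_l; rewrite (size0nil sl) big_nil => /rowP/(_ (enum_rank u)).
  rewrite mxE mxE !cE eqxx; case: eqVneq => [<- _|_ /eqP //].
  by exists [::].
have [<-|ne_uv] := eqVneq u v; first by exists [::].
have [s sl_s s_u] : exists2 s, s \in l & s 0 (enum_rank u) != 0.
  apply/hasP; apply/negPn; rewrite -all_predC; apply/negP => /allP z.
  move/rowP/(_ (enum_rank u)): sum_l; rewrite summxE big_seq big1.
    by rewrite mxE !cE eqxx (negbTE ne_uv) addr0 => /eqP.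
  by move=> s /z /= /negPn/eqP.
have [w auw es] : exists2 w, adj u w & s = c u + c w.
  have /edgesP[a [b [ab es]]] := le_l _ sl_s.
  move: s_u; rewrite es mxE !cE; case: (eqVneq u a) => [->|_].
    by exists b.
  case: (eqVneq u b) => [->|_]; last by rewrite addr0 eqxx.
  by exists a; rewrite 1?adj_sym // addrC.
have [] := IH (rem s l) w v.
- by rewrite size_rem // sl.
- by move=> x /mem_rem /le_l.
- move: sum_l; rewrite (big_rem s) //= => /(congr1 (+%R s)).
  by rewrite addrA addvv add0r => ->; rewrite es addrACA addvv add0r.
by move=> p [pp lp sp]; exists (w :: p); rewrite /= auw pp lp.
Qed.

Let cayley_steps k (S : {set 'rV['Z_2]_k}) p : forall g, path (cayley S) g p ->
  exists l, [/\ size l = size p, {subset l <= S} &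
                last g p = g + \sum_(s <- l) s].
Proof.
elim: p => [|h p IH] g /=; first by exists [::]; rewrite big_nil addr0.
case/andP=> /exists_inP[s sS /eqP ->] /IH[l [sl lS ->]].
exists (s :: l); rewrite /= sl big_cons addrA; split => // x.
by rewrite inE => /predU1P[->|/lS].
Qed.

Lemma ex_embeds : exists k, embeds G k.
Proof.
have /card_gt0P[r _] := vertex_gt0 G.
exists #|G|; apply/existsP; exists (c r |: edges).
have cay u v : adj u v -> cayley (c r |: edges) (c u) (c v).
  move=> a; apply/exists_inP; exists (c u + c v).
    by rewrite inE; apply/orP; right; apply/edgesP; exists u, v.
  by rewrite addrA addvv add0r.
apply/andP; split; first (apply/andP; split).
- rewrite !inE negb_or; apply/andP; split.
    apply/eqP => /(congr1 parity); rewrite parity_c /parity big1 => [/eqP //|i _].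
    by rewrite mxE.
  apply/negP => /existsP[u /existsP[v /andP[a /eqP]]].
  move/rowP/(_ (enum_rank u)); rewrite mxE mxE !cE eqxx.
  case: eqVneq a => [->|_ _ /eqP //]; by rewrite adj_irrefl.
- rewrite eqEsubset subsetT /=; apply/subsetP => x _.
  pose H := <<c r |: edges>>%G; change (x \in H); have H_c u : c u \in H.
    have /connectP[p pp ->] := adj_connected r u.
    elim/last_ind: p pp => [_|p w IH] /=; first by rewrite mem_gen ?inE ?eqxx.
    rewrite rcons_path last_rcons => /andP[/IH Hp a].
    rewrite -[c w]add0r -(addvv (c (last r p))) -addrA -FinRing.zmodMgE groupM //.
    by rewrite mem_gen // inE; apply/orP; right; apply/edgesP; exists (last r p), w.
  rewrite [x]row_sum_delta; elim/big_ind: _ => [|y z Hy Hz|i _].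
  + exact: (group1 H).
  + exact: (groupM Hy Hz).
  have := H_c (enum_val i); rewrite /c enum_valK => Hi.
  case: (x 0 i) => [[|[|]]] // lt_i; first by rewrite (_ : Ordinal _ = 0) ?scale0r; [exact: (group1 H)|exact: val_inj].
  by rewrite (_ : Ordinal _ = 1) ?scale1r //; exact: val_inj.
apply/existsP; exists [ffun u => c u].
apply/forallP => u; apply/forallP => v; rewrite !ffunE /gdist eqn_leq; apply/andP; split.
  have [p [pp lp <-]] := dist_attained (adj_connected u v).
  rewrite -(size_map c); apply: dist_min; last by rewrite last_map lp.
  by rewrite path_map; apply: sub_path pp => a b /cay.
have : connect (cayley (c r |: edges)) (c u) (c v).
  have /connectP[p pp ->] := adj_connected u v.
  apply/connectP; exists (map c p); last by rewrite last_map.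
  by rewrite path_map; apply: sub_path pp => a b /cay.
case/dist_attained => q [/cayley_steps[l [sl lS ->]] eq <-].
have {}eq : \sum_(s <- l) s = c u + c v by rewrite -eq addrA addvv add0r.
pose l' := [seq s <- l | s \in edges].
have l'E : {subset l' <= edges} by move=> s; rewrite mem_filter => /andP[].
have split_l : \sum_(s <- l) s = \sum_(s <- l') s
    + c r *+ count (predC (mem edges)) l.
  rewrite (bigID (mem edges)) /= -big_filter; congr (_ + _).
  rewrite -sum1_count -sumrMnr [RHS]big_seq_cond [LHS]big_seq_cond.
  apply: eq_bigr => s /andP[/lS]; rewrite !inE => /predU1P[->|sE] //.
  by move=> /negP.
have cr0 : c r *+ count (predC (mem edges)) l = 0.
  have par0 : parity (\sum_(s <- l') s) = 0.
    rewrite big_seq; elim/big_ind: _ => [|x y px py|s /l'E /edgesP[a [b [_ ->]]]].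
    - by rewrite /parity big1 // => i _; rewrite mxE.
    - by rewrite parityD px py addr0.
    - exact: parity_cc.
  have := congr1 parity split_l; rewrite eq parity_cc parityD par0 add0r.
  rewrite -[count _ l]odd_double_half mulrnDr -mul2n mulrnA mulr2n addvv mul0rn addr0.
  by case: odd => //; rewrite parity_c => /eqP.
move: split_l; rewrite eq cr0 addr0 => /esym sum_l'.
have [p [pp lp sp]] := edge_path erefl l'E sum_l'.
apply: leq_trans (dist_min pp lp) (leq_trans sp _).
by rewrite -sl size_filter count_size.
Qed.

End Existence.

Definition kmin (G : graph) : nat := ex_minn (ex_embeds G).

(* Main.v *)
(* If x_1, ..., x_d are the steps of a geodesic of the Cayley graph,
   then the 2^d subset sums of the x_i are pairwise distinct. Indeed, equal sums
   over distinct A and B make the sum over their symmetric difference vanish, so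
   deleting those steps gives a shorter walk with the same ends. Hence
   2^d <= 2^k, so a distance-preserving map bounds the diameter by k; being
   injective, it also bounds the number of vertices by 2^k. *)
Require Import Defs.
From mathcomp Require Import all_boot all_algebra all_fingroup.

Import GRing.Theory.

Section CayleyGraph.
Variables (k : nat) (S : {set 'rV['Z_2]_k}).
Local Open Scope ring_scope.
Local Notation V := 'rV['Z_2]_k.

(** Only the sum of the steps fixes the endpoint, so steps whose sum vanishes can be cut out of a
    walk. *)
Lemma walk_cayleyP m g h :
  reflect (exists l : seq V,
             [/\ size l = m, {subset l <= S} & h = g + \sum_(s <- l) s])
          (walk (cayley S) m g h).
Proof.
apply: (iffP (walkP _ _ _ _)) => [[p [pp <- <-]]|[l [<- lS ->]]].
  elim: p g pp => [|x p IH] g /=; first by exists [::]; rewrite big_nil addr0.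
  case/andP=> /exists_inP[s sS /eqP ->] /IH[l [sl lS ->]].
  exists (s :: l); rewrite /= sl big_cons addrA; split => // y.
  by rewrite inE => /predU1P[->|/lS].
elim: l g lS => [|s l IH] g lS; first by exists [::]; rewrite big_nil addr0.
have [|p [pp lp sp]] := IH (g + s); first by move=> y yl; apply: lS; rewrite inE yl orbT.
exists (g + s :: p); rewrite /= lp sp big_cons addrA pp andbT; split=> //.
by apply/exists_inP; exists s; rewrite // lS ?mem_head.
Qed.

Lemma connect_cayley g h : connection_set S -> connect (cayley S) g h.
Proof.
case/andP=> _ /eqP genS.
(* Quantifying over every start [a] lets two translations be chained, so [H] is a subgroup; it
   contains [S], hence is everything. *)
pose H := [set x : V | [forall a, connect (cayley S) a (a + x)]].
have HP x : reflect (forall a, connect (cayley S) a (a + x)) (x \in H).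
  by rewrite inE; apply: forallP.
have grH : group_set H.
  apply/group_setP; split=> [|x y /HP Hx /HP Hy]; apply/HP => a.
    by rewrite FinRing.zmod1gE addr0 connect0.
  by rewrite FinRing.zmodMgE addrA; apply: connect_trans (Hx a) (Hy _).
have /subsetP sTH : [set: V] \subset Group grH.
  rewrite -genS gen_subG; apply/subsetP => s sS; apply/HP => a; apply: connect1.
  by apply/exists_inP; exists s.
by have /HP/(_ g) := sTH (h - g) (in_setT _); rewrite addrC subrK.
Qed.

Lemma dist_cayley_le g h : connection_set S -> (dist (cayley S) g h <= k)%N.
Proof.
move=> csS; set d := dist _ g h.
have : walk (cayley S) d g h.
  by apply/walkP; apply/dist_attained/connect_cayley.
case/walk_cayleyP => l [sl lS eh].
(* Steps are indexed by position, so equal steps still count separately and there are 2^d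
   subsets. *)
pose s (i : 'I_d) := l`_i.
have sS i : s i \in S by apply/lS/mem_nth; rewrite sl.
have {}eh : h = g + \sum_i s i by rewrite eh (big_nth 0) sl big_mkord.
pose sigma (A : {set 'I_d}) : V := \sum_i s i *+ (i \in A).
suff inj : injective sigma.
  have := leq_card sigma inj.
  by rewrite card_mx card_ord mul1n -cardsT -powersetT card_powerset cardsT card_ord leq_exp2l.
move=> A B eAB; apply/eqP/negPn/negP => neAB.
(* [C] is the complement of the symmetric difference: the steps that are kept. *)
pose C := [set i | (i \in A) == (i \in B)].
have sC : \sum_(i in C) s i = \sum_i s i.
  (* In [sigma A + sigma B] the steps common to [A] and [B] occur twice and cancel in characteristic
     2. *)
  have -> : \sum_i s i = \sum_(i in C) s i + (sigma A + sigma B).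
    rewrite [\sum_(i in C) _]big_mkcond -!big_split; apply: eq_bigr => i _ /=; rewrite inE.
    by case: (i \in A); case: (i \in B); rewrite /= ?mulr1n ?Defs.addvv ?addr0 ?add0r.
  by rewrite eAB Defs.addvv addr0.
have ltC : (#|C| < d)%N.
  rewrite -[ltnRHS]card_ord -cardsT proper_card // properT.
  apply: contraNneq neAB => CT; apply/eqP/setP => i; apply/eqP.
  by have := in_setT i; rewrite -CT inE.
have : walk (cayley S) #|C| g h.
  apply/walk_cayleyP; exists (image s C); rewrite size_image big_image /= sC.
  by split=> // x /imageP[i _ ->].
case/walkP => p [pp lp sp]; have := dist_min pp lp.
by rewrite sp leqNgt ltC.
Qed.

End CayleyGraph.

Lemma dist_eq0 (T : finType) (e : rel T) x y :
  connect e x y -> (dist e x y == 0) = (x == y).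
Proof.
move=> /dist_attained[p [_ lp sp]]; apply/eqP/eqP => [d0|<-].
  by move: sp lp; rewrite d0 => /size0nil ->.
by apply/eqP; rewrite -leqn0; apply: (@dist_min _ _ [::]).
Qed.

Theorem theorem2p35 (G : graph) (n : nat) (hn : #|G| = n) :
  maxn (diam G) (up_log 2 n) <= kmin G.
Proof.
rewrite /kmin; case: ex_minnP => k /existsP[S /andP[csS /existsP[f /forallP fP]]] _.
have {}fP u v : dist (cayley S) (f u) (f v) = gdist u v.
  by have /forallP/(_ v)/eqP := fP u.
rewrite geq_max; apply/andP; split.
  by apply/bigmax_leqP => u _; apply/bigmax_leqP => v _; rewrite -fP dist_cayley_le.
have f_inj : injective f.
  (* Equal images are at distance 0, and [f] carries this back to [u] and [v]. *)
  move=> u v fuv; apply/eqP; rewrite -(dist_eq0 _ _ _ _ (adj_connected u v)).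
  by rewrite -/(gdist u v) -fP dist_eq0 ?connect_cayley // fuv.
(* [up_log 2 n] is the least exponent [e] with n <= 2^e, so counting the 2^k vectors suffices. *)
by apply: up_log_min => //; have := leq_card f f_inj; rewrite hn card_mx card_ord mul1n.
Qed.
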